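(* Let $\Gamma$ be a countable branch group acting faithfully on a spherically symmetric rooted tree $\mathsf{T}$, and let $\mu$ be an ergodic IRS of $\Gamma$ such that for $\mu$-a.e. $H$ the fixed point set $\mathrm{Fix}(H)\subseteq\partial\mathsf{T}$ is clopen (possibly empty). Then $\mu$ is atomic. Suppose in addition that $\Gamma$ is just infinite; then $\mu$-a.e. $H$ is a finite index subgroup of $\mathrm{Fix}_\Gamma(C)$, where $C=\mathrm{Fix}(H)$.
   Context: An IRS of a countable group $\Gamma$ is a Borel probability measure on $\mathrm{Sub}(\Gamma)\subset\{0,1\}^\Gamma$ invariant under conjugation; it is ergodic if ergodic for the conjugation action. A spherically symmetric rooted tree $\mathsf{T}$ has vertices the words $v_1\ldots v_n$ with $v_j\in\{0,\ldots,d_j-1\}$ for a fixed sequence of integers $d_j\ge2$; $\partial\mathsf{T}$ is the space of infinite rays, on which $\Gamma$ acts on the right. For a subgroup $H$, $\mathrm{Fix}(H)=\{x\in\partial\mathsf{T}: x\cdot h=x\ \forall h\in H\}$. For closed $K\subseteq\partial\mathsf{T}$, $\mathrm{Fix}_\Gamma(K)=\{g\in\Gamma: x\cdot g=x\ \forall x\in K\}$ is the pointwise stabilizer. For a vertex $u$, $\mathrm{Rist}_\Gamma(u)$ is the subgroup of elements acting trivially outside the subtree rooted at $u$; the $m$-th level rigid stabilizer $\mathrm{Rist}_m^\Gamma(\mathsf{T})$ is the product of $\mathrm{Rist}_\Gamma(u)$ over vertices $u$ of level $m$. $\Gamma$ is a branch group if it acts transitively on every level, every $\mathrm{Rist}_\Gamma(u)$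 is non-trivial, and $\mathrm{Rist}_m^\Gamma(\mathsf{T})$ has finite index in $\Gamma$ for all $m$. A group is just infinite if it is infinite and all of its proper quotients are finite. *)

(* Defs.v *)
From HB Require Import structures.
From mathcomp Require Import all_boot all_order all_algebra.
From mathcomp Require Import all_classical all_reals all_analysis.

Set Implicit Arguments.
Unset Strict Implicit.
Unset Printing Implicit Defensive.

Local Open Scope classical_set_scope.
Local Open Scope group_scope.

Section Tree.
Variable d : nat -> nat.

(* Letters are indexed from 0: the letter at position [i] of a word lies in
   {0, ..., d i - 1}, so [d i] is the number of children of a vertex of
   level [i]. *)
Definition vertex (n : nat) : finType := {dffun forall i : 'I_n, 'I_(d i)}.

Definition parent n (v : vertex n.+1) : vertex n :=
  [ffun i : 'I_n => (v (widen_ord (leqnSn n) i) : 'I_(d i))].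

Definition in_subtree n (u : vertex n) m (v : vertex m) : Prop :=
  exists le_nm : n <= m,
    forall i : 'I_n, u i = v (widen_ord le_nm i) :> nat.

Definition boundary : topologicalType :=
  prod_topology (fun j : nat => discrete_topology 'I_(d j)).

Definition ray_prefix (x : boundary) (n : nat) : vertex n :=
  [ffun i : 'I_n => (x i : 'I_(d i))].

End Tree.

(* A right action by automorphisms of the rooted tree: each level is
   preserved (by typing; in particular the root is fixed), and so is the
   parent relation. *)
Record tree_action (d : nat -> nat) (G : groupType) := TreeAction {
  vact :> forall n, vertex d n -> G -> vertex d n;
  vact1 : forall n (v : vertex d n), vact v 1 = v;
  vactM : forall n (v : vertex d n) (g h : G),
    vact v (g * h) = vact (vact v g) h;
  vact_parent : forall n (v : vertex d n.+1) (g : G),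
    parent (vact v g) = vact (parent v) g }.

Section Action.
Variables (d : nat -> nat) (G : groupType) (a : tree_action d G).

Definition faithful_action : Prop :=
  forall g : G, (forall n (v : vertex d n), a n v g = v) -> g = 1.

(* The induced action on rays; see [ray_prefix_act]. *)
Definition ray_act (x : boundary d) (g : G) : boundary d :=
  fun n => a n.+1 (ray_prefix x n.+1) g ord_max.

Lemma parent_ray_prefix (x : boundary d) n :
  parent (ray_prefix x n.+1) = ray_prefix x n.
Proof. by apply/ffunP => i; rewrite !ffunE. Qed.

Lemma ray_prefix_act (x : boundary d) (g : G) n :
  ray_prefix (ray_act x g) n = a n (ray_prefix x n) g.
Proof.
elim: n => [|n IHn]; first by apply/ffunP => -[].
apply/ffunP => i; rewrite ffunE.
have [lt_in|le_ni] := ltnP i n; last first.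
  suff -> : i = ord_max by [].
  by apply/val_inj/anti_leq; rewrite /= le_ni -ltnS ltn_ord.
have -> : i = widen_ord (leqnSn n) (Ordinal lt_in) by exact: val_inj.
move: IHn; rewrite -(parent_ray_prefix x n) -vact_parent => /ffunP.
by move=> /(_ (Ordinal lt_in)); rewrite !ffunE.
Qed.

Definition Fix (H : set G) : set (boundary d) :=
  [set x | forall h, H h -> ray_act x h = x].

Definition pstab (K : set (boundary d)) : set G :=
  [set g | forall x, K x -> ray_act x g = x].

Definition Rist n (u : vertex d n) : set G :=
  [set g | forall m (v : vertex d m), ~ in_subtree u v -> a m v g = v].

(* For a faithful action, rigid stabilizers of distinct vertices of the same
   level commute, so the order of the factors is immaterial. *)
Definition Rist_level (m : nat) : set G :=
  [set g | exists f : vertex d m -> G,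
     (forall u, Rist u (f u)) /\ g = \prod_(u : vertex d m) f u].

End Action.

Definition finite_index (G : groupType) (K H : set G) : Prop :=
  K `<=` H /\ finite_set [set [set k * h | k in K] | h in H].

Definition branch_group (d : nat -> nat) (G : groupType) (a : tree_action d G) :
    Prop :=
  [/\ forall n (u v : vertex d n), exists g : G, a n u g = v,
      forall n (u : vertex d n), exists2 g : G, Rist a u g & g <> 1
    & forall m, finite_index (Rist_level a m) [set: G]].

Section Subgroups.
Variable G : groupType.

Definition subgroups : set {ptws G -> bool} :=
  [set H | group_closed (H : {pred G})].

(* Sub(G), with the topology induced from the product {0,1}^G. *)
Definition subgroup_space : Type := set_type subgroups.

HB.instance Definition _ := Topological.on subgroup_space.

Definition carrier (H : subgroup_space) : set G := [set g | set_val H g].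

Lemma trivial_subgroup : subgroups (pred1 1).
Proof.
split=> [|x y]; first exact: eqxx.
by rewrite !unfold_in /= => /eqP-> /eqP->; rewrite divg1.
Qed.

HB.instance Definition _ :=
  isPointed.Build subgroup_space (SigSub (mem_set trivial_subgroup)).

Lemma conj_subgroup (H : subgroup_space) (g : G) :
  subgroups (fun x => set_val H (x ^ g^-1)).
Proof.
have [H1 HF] := set_valP H; split=> [|x y].
  by rewrite unfold_in conj1g.
rewrite !unfold_in => Hx Hy; rewrite conjMg conjVg.
exact: HF.
Qed.

(* g^-1 H g *)
Definition conj_sub (g : G) (H : subgroup_space) : subgroup_space :=
  SigSub (mem_set (conj_subgroup H g)).

Definition SubBorel := g_sigma_algebraType (@open subgroup_space).

HB.instance Definition _ := Measurable.on SubBorel.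

Definition normal_sub (N : subgroup_space) : Prop :=
  forall g : G, conj_sub g N = N.

(* The quotient by N is the set of cosets of N, so it is finite iff N has
   finite index. *)
Definition just_infinite : Prop :=
  infinite_set [set: G] /\
  forall N : subgroup_space, normal_sub N -> carrier N <> [set 1] ->
    finite_index (carrier N) [set: G].

End Subgroups.

Section IRS.
Variables (G : groupType) (R : realType) (mu : probability (SubBorel G) R).

Definition is_IRS : Prop :=
  forall (g : G) (A : set (SubBorel G)), measurable A ->
    mu (conj_sub g @^-1` A) = mu A.

Definition conj_ergodic : Prop :=
  forall A : set (SubBorel G), measurable A ->
    (forall g : G, conj_sub g @^-1` A = A) ->
    mu A = 0%E \/ mu A = 1%E.

(* mu is purely atomic: it is carried by the points of positive mass. *)
Definition atomic : Prop :=
  {ae mu, forall H : SubBorel G, (0 < mu [set H])%E}.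

End IRS.

(* Main.v *)
(* Fix [g] in [H] moving a vertex [u], and let [L] be the rigid stabilizer of
   [u].  The set of [x] in [L] such that [x * g^-1 * b] lies in [H] for some [b]
   in [L] is a coset of a subgroup [P] of [L]; conjugating [H] by [L] fixes [P]
   and translates the coset, so by invariance of [mu] the index of [P] in [L] is
   almost surely finite.  Hence if [v = u g] is another vertex of the orbit
   [u H], then for [x] in a finite index subgroup of [L] some [x * y] with [y]
   supported below [v] lies in [H].  When [u H] has two further points
   [v <> w], commuting [x * y] with [x' * y'] for supports [v] and [w] shows that
   [H] contains the commutators of a finite index subgroup [K_u] of [L].

   Orbits of rays under finite index subgroups of rigid stabilizers are infinite,
   so every ray outside [Fix H] has a prefix whose orbit has three points, and if
   [Fix H] is clopen then by compactness a single level [m] serves all of them.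
   Let [B] be the product of the [K_u] over level [m]: it has finite index in [G]
   and normalizes [D := H /\ B], because its commutators with [D] fix [Fix H]
   pointwise and are in [H] elsewhere.  So [D] has finitely many conjugates and,
   by ergodicity, almost surely runs over one countable family of subgroups; as
   [D] has finite index in [H], countably many [H] carry [mu].

   If [G] is just infinite, the derived subgroup of the normal core of [B] has
   finite index in [G], and its elements that fix [Fix H] pointwise are in [H]. *)
Require Import Defs.
From mathcomp Require Import all_boot all_order all_algebra.
From mathcomp Require Import all_classical all_reals all_analysis.

Local Open Scope classical_set_scope.
Set Implicit Arguments.
Unset Strict Implicit.
Unset Printing Implicit Defensive.

Import Order.TTheory GRing.Theory Num.Theory.

Local Open Scope group_scope.

(** * Rays, their prefixes and the size of the levels *)

Section Rays.
Variable d : nat -> nat.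
Implicit Types x y : boundary d.

Lemma eq_ray x y : (forall n, ray_prefix x n = ray_prefix y n) -> x = y.
Proof.
move=> eq_xy; apply: functional_extensionality_dep => n.
by move/ffunP: (eq_xy n.+1) => /(_ ord_max); rewrite !ffunE.
Qed.

Lemma eq_ray_prefix x y m n :
  (m <= n)%N -> ray_prefix x n = ray_prefix y n -> ray_prefix x m = ray_prefix y m.
Proof.
move=> le_mn /ffunP eq_xy; apply/ffunP => i.
by move: (eq_xy (widen_ord le_mn i)); rewrite !ffunE.
Qed.

Hypothesis hd : forall j, (2 <= d j)%N.

Lemma ray_through n (u : vertex d n) : exists x, ray_prefix x n = u.
Proof.
have d0 j : (0 < d j)%N by apply: leq_trans (hd j).
exists (fun j => match pselect (j < n)%N with
  | left lt_jn => u (Ordinal lt_jn) | right _ => Ordinal (d0 j) end).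
apply/ffunP => -[i lt_in]; rewrite ffunE /=.
by case: pselect => // lt_in'; rewrite (bool_irrelevance lt_in lt_in').
Qed.

Lemma card_vertex n : (n < #|vertex d n|)%N.
Proof.
rewrite card_dep_ffun foldrE big_map.
rewrite big_enum /=.
rewrite (eq_bigr (fun i : 'I_n => d i)) => [|i _]; last by rewrite card_ord.
apply: (@leq_trans (2 ^ n)); first exact: ltn_expl.
rewrite -[X in (2 ^ X)%N]card_ord -prod_nat_const.
exact: leq_prod.
Qed.

End Rays.

(** * The action on rays and rigid stabilizers *)

Section RigidStabilizers.
Variables (d : nat -> nat) (hd : forall j, (2 <= d j)%N).
Variables (G : groupType) (a : tree_action d G) (ha : faithful_action a).
Implicit Types (x y : boundary d) (g h b c : G).

Lemma ray_act1 x : ray_act a x 1 = x.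
Proof. by apply: eq_ray => n; rewrite ray_prefix_act vact1. Qed.

Lemma ray_actM x g h : ray_act a x (g * h) = ray_act a (ray_act a x g) h.
Proof. by apply: eq_ray => n; rewrite !ray_prefix_act vactM. Qed.

Lemma ray_actK x g : ray_act a (ray_act a x g) g^-1 = x.
Proof. by rewrite -ray_actM mulgV ray_act1. Qed.

Lemma ray_actKV x g : ray_act a (ray_act a x g^-1) g = x.
Proof. by rewrite -ray_actM mulVg ray_act1. Qed.

Lemma eq_ray_act g h : (forall x, ray_act a x g = ray_act a x h) -> g = h.
Proof.
move=> eq_gh; apply/eqP; rewrite -divg_eq1; apply/eqP/ha => n v.
have [x <-] := ray_through hd v.
by rewrite -ray_prefix_act ray_actM eq_gh ray_actK.
Qed.

(** The rigid stabilizer read on rays instead of vertices, so that identities in [G] can be checked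
    ray by ray with [eq_ray_act]. *)
Definition ray_rist n (u : vertex d n) : set G :=
  [set g | forall x, ray_prefix x n <> u -> ray_act a x g = x].

Lemma Rist_ray_rist n (u : vertex d n) : Rist a u `<=` ray_rist u.
Proof.
move=> g ug x xu; apply: eq_ray => m; rewrite ray_prefix_act.
apply: ug => -[le_nm eq_ux]; apply: xu; apply/ffunP => i.
by rewrite ffunE; apply: val_inj; rewrite /= eq_ux ffunE.
Qed.

Section OneVertex.
Variables (n : nat) (u : vertex d n).

Lemma ray_rist1 : ray_rist u 1.
Proof. by move=> x _; exact: ray_act1. Qed.

Lemma ray_ristM g h : ray_rist u g -> ray_rist u h -> ray_rist u (g * h).
Proof. by move=> ug uh x xu; rewrite ray_actM ug // uh. Qed.

Lemma ray_ristV g : ray_rist u g -> ray_rist u g^-1.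
Proof. by move=> ug x xu; rewrite -{1}(ug x xu) ray_actK. Qed.

Lemma ray_rist_prefix g x :
  ray_rist u g -> ray_prefix x n = u -> ray_prefix (ray_act a x g) n = u.
Proof.
move=> ug xu; apply: contrapT => xgu.
have /(congr1 (fun z => ray_act a z g^-1)) := ug _ xgu.
by rewrite !ray_actK => xg; apply: xgu; rewrite xg.
Qed.

Lemma ray_ristJ g h : ray_rist u g -> ray_rist (a n u h) (h^-1 * g * h).
Proof.
move=> ug x xu; rewrite !ray_actM ug ?ray_actKV // => xhu.
by apply: xu; rewrite -xhu -ray_prefix_act ray_actKV.
Qed.

End OneVertex.

Lemma ray_rist_commute n (u v : vertex d n) b c :
  u <> v -> ray_rist u b -> ray_rist v c -> b * c = c * b.
Proof.
move=> uv ub vc; apply: eq_ray_act => x; rewrite !ray_actM.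
have [xu|xu] := pselect (ray_prefix x n = u).
  by rewrite (vc x) ?xu // vc // (ray_rist_prefix ub).
rewrite (ub x) //; have [xv|xv] := pselect (ray_prefix x n = v).
  by rewrite ub // (ray_rist_prefix vc xv) => vu; apply: uv.
by rewrite vc // ub.
Qed.

End RigidStabilizers.

(** * Finite index through finite labellings *)

Section FiniteIndex.
Variable G : groupType.
Implicit Types (K L M S : set G) (x y g h : G).

Definition subgp S := S 1 /\ forall x y, S x -> S y -> S (x * y^-1).

Lemma subgpV S x : subgp S -> S x -> S x^-1.
Proof. by move=> [S1 SF] Sx; rewrite -[x^-1]mul1g; exact: SF. Qed.

Lemma subgpM S x y : subgp S -> S x -> S y -> S (x * y).
Proof.
by move=> sgS Sx Sy; rewrite -[y]invgK; apply: sgS.2 => //; exact: subgpV.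
Qed.

(** A labelling with finitely many values that separates the right cosets of [K] met by [L]. Neither
    [K <= L] nor a group structure is required, so the notion passes freely to a larger [K] or a
    smaller [L]. *)
Definition fidx K L : Prop :=
  exists (T : finType) (f : G -> T),
    forall x y, L x -> L y -> f x = f y -> K (x * y^-1).

Lemma fidxS K K' L L' : K `<=` K' -> L' `<=` L -> fidx K L -> fidx K' L'.
Proof.
move=> sK sL [T [f fK]]; exists T, f => x y /sL Lx /sL Ly fxy.
by apply: sK; apply: fK.
Qed.

Lemma fidx_bigcap (I : finType) (K : I -> set G) L :
  (forall i, fidx (K i) L) -> fidx [set x | forall i, K i x] L.
Proof.
move=> iK; pose T i := projT1 (cid (iK i)).
pose f i : G -> T i := projT1 (cid (projT2 (cid (iK i)))).
have fK i := projT2 (cid (projT2 (cid (iK i)))).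
exists {dffun forall i, T i}, (fun x => [ffun i => f i x]) => x y Lx Ly.
by move=> /ffunP fxy i; apply: (fK i) => //; move: (fxy i); rewrite !ffunE.
Qed.

Lemma fidxI K K' L : fidx K L -> fidx K' L -> fidx (K `&` K') L.
Proof.
move=> iK iK'; have := @fidx_bigcap bool (fun b => if b then K else K') L.
case=> [[]//|T [f fK]]; exists T, f => x y Lx Ly fxy.
by split; [exact: (fK _ _ Lx Ly fxy true) | exact: (fK _ _ Lx Ly fxy false)].
Qed.

Lemma fidx_trans L K M : fidx K L -> fidx L M -> fidx K M.
Proof.
move=> [T [f fK]] [T' [f' fL]].
(* [r] picks a representative in [M] for each label of [f'], with default [1] for labels not
   attained. An element [x] is then labelled by [f' x] and by the [f]-label of its quotient by the
   representative, which lies in [L]. *)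
have /choice[r rP] t : exists r, (exists2 x, M x & f' x = t) -> M r /\ f' r = t.
  have [[x Mx <-]|nx] := pselect (exists2 x, M x & f' x = t); first by exists x.
  by exists 1.
exists (T * T')%type, (fun x => (f (x * (r (f' x))^-1), f' x)) => x y Mx My.
move=> [+ f'xy]; rewrite -f'xy => fxy.
have [] := rP (f' x); first by exists x.
move: (r _) fxy => z fxy Mz f'z.
have := fK _ _ (fL _ _ Mx Mz (esym f'z)) (fL _ _ My Mz _) fxy.
by rewrite !gnorm; apply; rewrite f'z.
Qed.

Lemma finite_index_fidx K L : K 1 -> finite_index K L -> fidx K L.
Proof.
move=> K1 [_ /finite_seqP[s sE]].
pose coset x := [set k * x | k in K].
exists (option (seq_sub s)), (fun x => insub (coset x)) => x y Lx Ly.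
have ins z : L z -> coset z \in s.
  by move=> Lz; suff : [set` s] (coset z) by []; rewrite -sE; exists z.
rewrite !insubT ?ins // => _ _ [] eq_xy.
have : coset x x by exists 1 => //; rewrite mul1g.
by rewrite eq_xy => -[k Kk <-]; rewrite mulgK.
Qed.

Lemma fidx_finite_index K L :
  subgp K -> K `<=` L -> fidx K L -> finite_index K L.
Proof.
move=> sgK sKL [T [f fK]]; split=> //.
pose coset x := [set k * x | k in K].
pose rep t := xget set0 [set A | exists2 x, L x /\ f x = t & A = coset x].
apply: (@sub_finite_set _ _ (rep @` [set: T])); last first.
  exact/finite_image/finite_finset.
move=> _ [x Lx <-]; exists (f x) => //; rewrite /rep.
case: xgetP => [A _ [y [Ly fyx] ->]|/(_ (coset x))]; last by case; exists x.
rewrite eqEsubset; split=> _ [k Kk <-].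
  exists (k * (y * x^-1)); last by rewrite !gnorm.
  by apply: subgpM => //; exact: fK.
exists (k * (x * y^-1)); last by rewrite !gnorm.
by apply: subgpM => //; exact: fK.
Qed.

(** Greedy choice: if the cosets through the terms found so far covered [L], the position of the
    coset would be a finite labelling. *)
Lemma not_fidx_seq K L n : subgp K -> subgp L -> ~ fidx K L ->
  exists2 s : seq G, size s = n /\ (forall x, x \in s -> L x) &
    forall i j, (i < j < n)%N -> ~ K ((nth 1 s i)^-1 * nth 1 s j).
Proof.
move=> sgK sgL nKL; elim: n => [|n [s [szs sL] sK]].
  by exists [::] => // i j; rewrite ltn0 andbF.
have [h [Lh sh]] : exists h, L h /\ forall i, (i < n)%N -> ~ K ((nth 1 s i)^-1 * h).
  apply: contrapT => nh; apply: nKL.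
  (* The sequence concerns left cosets and [fidx] right ones, hence the inverse of [h]; the type
     ['I_n.+1] is inhabited even for [n = 0], which gives a default outside [L]. *)
  have /choice[f fP] h : exists i : 'I_n.+1, L h -> K ((nth 1 s i)^-1 * h^-1).
    have [Lh|nLh] := pselect (L h); last by exists ord0.
    apply: contrapT => ni; apply: nh; exists h^-1; split; first exact: subgpV.
    move=> i lt_in Ki; apply: ni; exists (widen_ord (leqnSn n) (Ordinal lt_in)).
    by move=> _.
  exists 'I_n.+1, f => x y Lx Ly fxy.
  have := sgK.2 _ _ (subgpV sgK (fP x Lx)) (subgpV sgK (fP y Ly)).
  by rewrite fxy !gnorm.
exists (rcons s h).
  split=> [|x]; first by rewrite size_rcons szs.
  by rewrite mem_rcons inE => /orP[/eqP->|/sL].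
move=> i j /andP[lt_ij]; rewrite ltnS leq_eqVlt => /orP[/eqP jn|lt_jn].
  rewrite !nth_rcons szs jn ltnn eqxx -{1}jn lt_ij; apply: sh.
  by rewrite -jn.
rewrite !nth_rcons szs lt_jn (ltn_trans lt_ij lt_jn); apply: sK.
by rewrite lt_ij.
Qed.

End FiniteIndex.

Lemma subgp_carrier (G : groupType) (H : subgroup_space G) : subgp (carrier H).
Proof. by have [H1 HF] := set_valP H; split=> // x y; exact: HF. Qed.

Lemma conj_subE (G : groupType) (g : G) (H : subgroup_space G) x :
  carrier (conj_sub g H) x <-> carrier H (g * x * g^-1).
Proof. by have -> : g * x * g^-1 = x ^ g^-1 by rewrite conjgE invgK mulgA. Qed.

Lemma eq_carrier (G : groupType) (H K : subgroup_space G) :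
  (forall x, carrier H x <-> carrier K x) -> H = K.
Proof.
move=> HK; apply: val_inj; apply: funext => x; apply/idP/idP => ?; exact/HK.
Qed.

(** * Measurability of predicates built with countable quantifiers *)

Section Measurability.
Variables (dT : measure_display) (T : measurableType dT).

Lemma measurable_pred_exists (I : Type) (P : I -> T -> Prop) :
  countable [set: I] -> (forall i, measurable [set x | P i x]) ->
  measurable [set x | exists i, P i x].
Proof.
move=> cI mP; rewrite (_ : mkset _ = \bigcup_i [set x | P i x]).
  exact: countable_bigcupT_measurable.
by apply/seteqP; split=> x [i]; exists i.
Qed.

Lemma measurable_predC (P : T -> Prop) :
  measurable [set x | P x] -> measurable [set x | ~ P x].
Proof. exact: measurableC. Qed.

Lemma measurable_pred_forall (I : Type) (P : I -> T -> Prop) :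
  countable [set: I] -> (forall i, measurable [set x | P i x]) ->
  measurable [set x | forall i, P i x].
Proof.
move=> cI mP; rewrite (_ : mkset _ = [set x | ~ exists i, ~ P i x]).
  apply: measurable_predC; apply: measurable_pred_exists => // i.
  exact: measurable_predC.
apply/seteqP; split=> x /= Px; first by case=> i; apply; exact: Px.
by move=> i; apply: contrapT => nPi; apply: Px; exists i.
Qed.

Lemma measurable_predI (P Q : T -> Prop) :
  measurable [set x | P x] -> measurable [set x | Q x] ->
  measurable [set x | P x /\ Q x].
Proof. exact: measurableI. Qed.

Lemma measurable_pred_exists2 (I : Type) (P Q : I -> T -> Prop) :
  countable [set: I] -> (forall i, measurable [set x | P i x]) ->
  (forall i, measurable [set x | Q i x]) ->
  measurable [set x | exists2 i, P i x & Q i x].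
Proof.
move=> cI mP mQ; rewrite (_ : mkset _ = [set x | exists i, P i x /\ Q i x]).
  by apply: measurable_pred_exists => // i; exact: measurable_predI.
by apply/seteqP; split=> x /= [i]; [exists i | case; exists i].
Qed.

Lemma measurable_pred_imply (P Q : T -> Prop) :
  measurable [set x | P x] -> measurable [set x | Q x] ->
  measurable [set x | P x -> Q x].
Proof.
move=> mP mQ; rewrite (_ : mkset _ = ~` [set x | P x] `|` [set x | Q x]).
  by apply: measurableU => //; exact: measurableC.
apply/seteqP; split=> x /=; last by case.
by move=> PQ; have [/PQ|] := pselect (P x); [right | left].
Qed.

Lemma measurable_pred_cst (P : Prop) : measurable [set _ : T | P].
Proof.
have [p|np] := pselect P.
  rewrite (_ : mkset _ = setT); first exact: measurableT.
  by apply/seteqP; split.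
rewrite (_ : mkset _ = set0); first exact: measurable0.
by apply/seteqP; split.
Qed.

Lemma measurable_pred_iff (P : T -> Prop) (Q : Prop) :
  measurable [set x | P x] -> measurable [set x | P x <-> Q].
Proof.
move=> mP; apply: measurable_predI; apply: measurable_pred_imply => //;
  exact: measurable_pred_cst.
Qed.

End Measurability.

Lemma measurable_carrier (G : groupType) (g : G) :
  measurable [set H : SubBorel G | carrier H g].
Proof.
apply: sub_sigma_algebra.
pose ev (f : {ptws G -> bool}) := f g.
have cev : continuous ev.
  exact: (@proj_continuous G (fun=> bool) g).
rewrite (_ : mkset _ =
    (set_val : subgroup_space G -> _) @^-1` (ev @^-1` [set true])).
  apply: open_comp => [x _|]; first exact: initial_continuous.
  apply: open_comp => [x _|]; first exact: cev.
  exact: discrete_open.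
by apply/seteqP; split.
Qed.

Lemma countable_enum (G : groupType) :
  countable [set: G] -> exists e : nat -> G, forall g, exists n, e n = g.
Proof.
move=> /pcard_leP[f].
exists (fun n => xget 1 [set g | f g = n]) => g; exists (f g).
case: xgetP => [h -> /= fhg|/(_ g)]; last by case.
by apply: ('inj_f); rewrite ?inE.
Qed.

(** * No invariant probability on an infinite set of cosets *)

Section InvariantCosets.
Variables (G : groupType) (hG : countable [set: G]) (R : realType).
Variables (mu : probability (SubBorel G) R) (hirs : is_IRS mu).
Variables (L : set G) (P C : SubBorel G -> set G).
Hypothesis sgL : subgp L.
Hypothesis sgP : forall H, subgp (P H).
Hypothesis mP : forall x, measurable [set H | P H x].
Hypothesis mC : forall x, measurable [set H | C H x].
Hypothesis PJ : forall g H, L g -> P (conj_sub g H) = P H.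
Hypothesis CJ : forall g H, L g -> C (conj_sub g H) 1 <-> C H g.
Hypothesis CP : forall H x y, L x -> L y -> C H x -> C H y -> P H (x^-1 * y).

(* The conditions say that [C H] is a left coset of [P H] in [L], that [P] is
   invariant and that [C] is translated by the action of [L]: given [P H], its
   law is an invariant probability on the countable set of cosets, which can
   only exist when this set is finite. *)
Lemma ae_fidx_of_invariant_coset :
  {ae mu, forall H, C H 1 -> fidx (P H) L}.
Proof.
have [e eP] := countable_enum hG.
(* An enumeration of all finite sequences in [G], so that the existence of coset representatives
   becomes a countable union. *)
pose tup k : seq G := map e (odflt [::] (unpickle k)).
have tupP s : exists k, tup k = s.
  have [c <-] : exists c, map e c = s.
    elim: s => [|g s [c <-]]; first by exists [::].
    by have [n <-] := eP g; exists (n :: c).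
  by exists (pickle c); rewrite /tup pickleK.
pose Y n k := [set H | [/\ size (tup k) = n, forall x, x \in tup k -> L x &
  forall i j, (i < j < n)%N -> ~ P H ((nth 1 (tup k) i)^-1 * nth 1 (tup k) j)]].
(* The exceptional set, on which [L] meets arbitrarily many cosets of [P H]; it is null because
   [n * mu A <= 1] for all [n]. *)
pose A := [set H | C H 1 /\ forall n, exists k, Y n k H].
have mY n k : measurable (Y n k).
  rewrite (_ : Y n k = [set H | (size (tup k) = n /\ forall x, x \in tup k -> L x) /\
    forall i j, (i < j < n)%N ->
      ~ P H ((nth 1 (tup k) i)^-1 * nth 1 (tup k) j)]); last first.
    by apply/seteqP; split=> H; [case | case; case].
  apply: measurable_predI; first exact: measurable_pred_cst.
  apply: measurable_pred_forall => // i; apply: measurable_pred_forall => // j.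
  apply: measurable_pred_imply; first exact: measurable_pred_cst.
  exact: measurable_predC.
have mA : measurable A.
  apply: measurable_predI => //; apply: measurable_pred_forall => // n.
  by apply: measurable_pred_exists => // k; exact: mY.
have YJ n k g : L g -> conj_sub g @^-1` Y n k = Y n k.
  by move=> Lg; apply/seteqP; split=> H; rewrite /Y /= PJ.
have n_muA n : (n%:R%:E * mu A <= 1)%E.
  (* [Z k] keeps the [H] for which [tup k] is the first witness. Since [Y n] depends on [H] through
     [P H] only, conjugation by [L] preserves each [Z k]. *)
  pose Z := seqDU (Y n).
  have mZ k : measurable (Z k) by exact: seqDU_measurable.
  have ZJ k g : L g -> conj_sub g @^-1` Z k = Z k.
    move=> Lg; have YH H i : Y n i (conj_sub g H) <-> Y n i H.
      by rewrite -[Y n i (_ _)]/((conj_sub g @^-1` Y n i) H) YJ.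
    apply/seteqP; split=> H; rewrite /Z /seqDU -!bigcup_mkord /preimage /=.
      by case=> /YH Yk nY; split=> // -[i ik /YH Yi]; apply: nY; exists i.
    by case=> /YH Yk nY; split=> // -[i ik /YH Yi]; apply: nY; exists i.
  pose B k x := Z k `&` [set H | C H x].
  have mB k x : measurable (B k x) by exact: measurableI.
  have muB k x : L x -> mu (B k x) = mu (B k 1%g).
    move=> Lx; rewrite -(hirs x (mB k 1)); congr (mu _).
    rewrite /B preimage_setI ZJ //; congr (_ `&` _).
    by apply/seteqP; split=> H /=; rewrite CJ.
  (* By [CP], [C H] contains at most one of the [n] listed elements, so the sets [B k x] for [x] in
     the list are disjoint in [Z k]; by [muB] they have equal mass. *)
  have n_muB k : (n%:R%:E * mu (B k 1%g) <= mu (Z k))%E.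
    have [[sz_k Lk]|nk] :=
        pselect (size (tup k) = n /\ forall x, x \in tup k -> L x); last first.
      suff -> : B k 1 = set0 by rewrite measure0 mule0.
      by apply/seteqP; split=> // H [[[]]] sz_k Lk; case: nk.
    pose F (i : nat) := B k (nth 1 (tup k) i).
    have Lnth i : (i < n)%N -> L (nth 1 (tup k) i).
      by move=> lt_in; apply: Lk; rewrite mem_nth // sz_k.
    have trivF : trivIset `I_n F.
      have disj i j H : (i < j < n)%N -> F i H -> F j H -> False.
        move=> /andP[lt_ij lt_jn] [[[_ _ Yk] _] Ci] [_ Cj].
        apply: (Yk i j); first by rewrite lt_ij.
        by apply: CP => //; apply: Lnth => //; exact: ltn_trans lt_jn.
      move=> i j /= lt_in lt_jn [H [Fi Fj]]; apply/eqP.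
      case: ltngtP => //= lt_ij; exfalso.
        by apply: (disj i j H) => //; rewrite lt_ij.
      by apply: (disj j i H) => //; rewrite lt_ij.
    have <- : (\sum_(i < n) mu (F i) = n%:R%:E * mu (B k 1%g))%E.
      rewrite (eq_bigr (fun=> mu (B k 1%g))) => [|i _]; last by apply/muB/Lnth.
      by rewrite big_const_ord mule_natl /enatmul Monoid.iteropE.
    have mF i : measurable (F i) by exact: mB.
    have mUF : measurable (\big[setU/set0]_(i < n) F i).
      by apply: bigsetU_measurable => i _; exact: mF.
    rewrite -measure_semi_additive_ord_I //.
    apply: le_measure; rewrite ?inE //.
    by rewrite -bigcup_mkord => H [i _ []].
  have AB : A `<=` \bigcup_j B j 1.
    move=> H [C1 /(_ n)[i Yi]].
    have : (\bigcup_k Z k) H by rewrite -seqDU_bigcup_eq; exists i.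
    by case=> j _ Zj; exists j.
  have trivB : trivIset setT (fun k => B k 1).
    move=> i j _ _ [H [[Zi _] [Zj _]]].
    by apply: (trivIset_seqDU (Y n)) => //; exists H.
  apply: (@le_trans _ _ (n%:R%:E * \sum_(0 <= k <oo) mu (B k 1%g)))%E.
    apply: lee_wpmul2l; first by rewrite lee_fin.
    have <- : mu (\bigcup_k B k 1%g) = (\sum_(0 <= k <oo) mu (B k 1%g))%E.
      by rewrite measure_bigcup //; apply: eq_eseriesl => i; rewrite in_setT.
    by apply: le_measure; rewrite ?inE //; exact: bigcup_measurable.
  rewrite -nneseriesZl //.
  apply: (@le_trans _ _ (\sum_(0 <= k <oo) mu (Z k)))%E.
    by apply: lee_nneseries => // k _ _; exact: mule_ge0.
  have <- : mu (\bigcup_k Z k) = (\sum_(0 <= k <oo) mu (Z k))%E.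
    rewrite measure_bigcup //; last exact: trivIset_seqDU.
    by apply: eq_eseriesl => i; rewrite in_setT.
  by apply: probability_le1; exact: bigcup_measurable.
have muA0 : mu A = 0%E.
  have [r r0 muAr] : exists2 r, (0 <= r)%R & mu A = r%:E.
    exists (fine (mu A)); first by rewrite fine_ge0.
    by rewrite fineK // fin_num_measure.
  apply/eqP; rewrite muAr eqe; apply: contrapT => /negP r_neq0.
  have r_gt0 : (0 < r)%R by rewrite lt_neqAle eq_sym r_neq0.
  have := n_muA (Num.bound r^-1); rewrite muAr -EFinM lee_fin leNgt => /negP; apply.
  rewrite -ltr_pdivrMr // mul1r.
  by have := archi_boundP (ltW (_ : 0 < r^-1))%R; apply; rewrite invr_gt0.
exists A; split=> // H /= /not_implyP[C1 nfidx]; split=> // n.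
have [s [sz_s Ls] sP] := not_fidx_seq n (sgP H) sgL nfidx.
by have [k kP] := tupP s; exists k; split; rewrite ?kP.
Qed.

End InvariantCosets.

Lemma ae_imply (dT : measure_display) (T : measurableType dT)
    (R : realType) (mu : {measure set T -> \bar R}%R) (P Q : T -> Prop) :
  (forall x, P x -> Q x) -> {ae mu, forall x, P x} -> {ae mu, forall x, Q x}.
Proof. by move=> PQ; apply: filterS. Qed.

Lemma ae_forall_countable (dT : measure_display) (T : measurableType dT)
    (R : realType) (mu : {measure set T -> \bar R}%R) (I : Type)
    (P : I -> T -> Prop) :
  countable [set: I] -> (forall i, {ae mu, forall x, P i x}) ->
  {ae mu, forall x, forall i, P i x}.
Proof.
elim/Pchoice: I => I in P *.
move=> /pcard_leP[f] aeP.
have : {ae mu, forall x, forall n, forall i, f i = n -> P i x}.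
  apply: ae_foralln => n.
  have [[i fin]|nin] := pselect (exists i, f i = n); last first.
    by apply: aeW => x i fin; case: nin; exists i.
  apply: filterS (aeP i) => x Pix j fjn.
  by have <- : i = j by apply: ('inj_f); rewrite ?inE //= fin fjn.
by apply: filterS => x Px i; exact: (Px (f i)).
Qed.

(** * Projections of an IRS to rigid stabilizers *)

Section ProjectionsOfIRS.
Variables (d : nat -> nat) (hd : forall j, (2 <= d j)%N).
Variables (G : groupType) (hG : countable [set: G]).
Variables (a : tree_action d G) (ha : faithful_action a).

Lemma subgp_ray_rist n (u : vertex d n) : subgp (ray_rist a u).
Proof.
split=> [|x y ux uy]; first exact: ray_rist1.
by apply: ray_ristM => //; exact: ray_ristV.
Qed.

(** For [u <> v], the projection to the first factor of the intersection of [H] with the product of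
    the rigid stabilizers of [u] and [v]. *)
Definition proj_rist (H : set G) n (u v : vertex d n) : set G :=
  [set x | ray_rist a u x /\ exists2 y, ray_rist a v y & H (x * y)].

Variables (R : realType) (mu : probability (SubBorel G) R) (hirs : is_IRS mu).

Lemma ae_fidx_proj_rist1 n (u : vertex d n) (g : G) : a n u g <> u ->
  {ae mu, forall H, carrier H g ->
     fidx (proj_rist (carrier H) u (a n u g)) (ray_rist a u)}.
Proof.
move=> ug; pose L := ray_rist a u.
have sgL : subgp L := subgp_ray_rist u.
(* [g * x * g^-1] is supported below [u g^-1], away from [u], and so commutes with [L]. Conjugating
   by [L] therefore changes only [b] in [P], while in [C] it multiplies [x] on one side and [b] on
   the other. *)
pose P (H : SubBorel G) : set G :=
  [set x | L x /\ exists b, L b /\ carrier H (g * x * g^-1 * b)].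
pose C (H : SubBorel G) : set G :=
  [set x | L x /\ exists b, L b /\ carrier H (x * g^-1 * b)].
have ugV : u <> a n u g^-1.
  by move=> eu; apply: ug; rewrite {1}eu -vactM mulVg vact1.
have comm x b : L x -> L b -> (g * x * g^-1) * b = b * (g * x * g^-1).
  move=> Lx Lb; apply/esym/(ray_rist_commute hd ha ugV Lb).
  by have := ray_ristJ (h := g^-1) Lx; rewrite invgK.
have sgP H : subgp (P H).
  have sgH := subgp_carrier H.
  split=> [|x y [Lx [b [Lb Hb]]] [Ly [c [Lc Hc]]]].
    split; first exact: sgL.1.
    by exists 1; split; [exact: sgL.1 | rewrite !gnorm; exact: sgH.1].
  split; first exact: sgL.2.
  exists (b * c^-1); split; first exact: sgL.2.
  have -> : g * (x * y^-1) * g^-1 * (b * c^-1) =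
      (g * x * g^-1 * b) * (g * y * g^-1 * c)^-1.
    have := comm y^-1 (b * c^-1) (subgpV sgL Ly) (sgL.2 _ _ Lb Lc).
    rewrite !gnorm => /(congr1 (fun z => g * x * g^-1 * z)).
    by rewrite !gnorm.
  exact: sgH.2.
have mex Q : (forall x, measurable [set H : SubBorel G | carrier H (Q x)]) ->
    measurable [set H : SubBorel G | exists b, L b /\ carrier H (Q b)].
  move=> mQ; apply: measurable_pred_exists => [|b]; first exact: hG.
  by apply: measurable_predI => //; exact: measurable_pred_cst.
have mP x : measurable [set H | P H x].
  apply: measurable_predI; first exact: measurable_pred_cst.
  by apply: mex => b; exact: measurable_carrier.
have mC x : measurable [set H | C H x].
  apply: measurable_predI; first exact: measurable_pred_cst.
  by apply: mex => b; exact: measurable_carrier.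
have commJ x h b : L x -> L h ->
    g * x * g^-1 * (h * b * h^-1) = h * (g * x * g^-1 * b) * h^-1.
  move=> Lx Lh; have := congr1 (fun z => z * b * h^-1) (comm x h Lx Lh).
  by rewrite !gnorm.
have PJ h H : L h -> P (conj_sub h H) = P H.
  move=> Lh; apply/seteqP; split=> x [Lx [b [Lb]]].
    move=> /conj_subE Hb; split=> //; exists (h * b * h^-1); split.
      by apply: (subgpM sgL) => //; [exact: (subgpM sgL) | exact: (subgpV sgL)].
    by rewrite commJ.
  move=> Hb; split=> //; exists (h^-1 * b * h); split.
    by apply: (subgpM sgL) => //; apply: (subgpM sgL) => //; exact: (subgpV sgL).
  by apply/conj_subE; rewrite -commJ // !gnorm.
have CJ h H : L h -> C (conj_sub h H) 1 <-> C H h.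
  move=> Lh; split=> -[_ [b [Lb]]].
    move=> /conj_subE Hb; split=> //; exists (b * h^-1); split.
      exact: sgL.2.
    by move: Hb; rewrite !gnorm.
  move=> Hb; split; first exact: sgL.1.
  exists (b * h); split; first exact: (subgpM sgL).
  by apply/conj_subE; move: Hb; rewrite !gnorm.
have CP H x y : L x -> L y -> C H x -> C H y -> P H (x^-1 * y).
  move=> Lx Ly [_ [b [Lb Hb]]] [_ [c [Lc Hc]]].
  have Lxy : L (x^-1 * y) by apply: (subgpM sgL) => //; exact: (subgpV sgL).
  split=> //; exists (b^-1 * c); split.
    by apply: (subgpM sgL) => //; exact: (subgpV sgL).
  rewrite mulgA comm //; last exact: (subgpV sgL).
  have := subgpM (subgp_carrier H) (subgpV (subgp_carrier H) Hb) Hc.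
  by rewrite !gnorm.
have := @ae_fidx_of_invariant_coset _ hG _ _ hirs L P C sgL sgP mP mC PJ CJ CP.
apply: filterS => H fidxP Hg; have sgH := subgp_carrier H.
(* For [g] in [H], conjugating [g * x * g^-1 * b] by [g] gives [x] times an element supported below
   [u g], and [g^-1] itself witnesses [C H 1]. *)
apply: fidxS (fidxP _) => //.
  move=> x [Lx [b [Lb Hb]]]; split=> //; exists (g^-1 * b * g).
    exact: ray_ristJ.
  have := subgpM sgH (subgpM sgH (subgpV sgH Hg) Hb) Hg.
  by rewrite !gnorm.
split; first exact: sgL.1.
exists 1; split; first exact: sgL.1.
by rewrite !gnorm; exact: (subgpV sgH).
Qed.

Lemma ae_fidx_proj_rist :
  {ae mu, forall H : SubBorel G, forall n (u : vertex d n) g, carrier H g ->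
     a n u g <> u -> fidx (proj_rist (carrier H) u (a n u g)) (ray_rist a u)}.
Proof.
have : {ae mu, forall H : SubBorel G, forall (v : {n & vertex d n}) g,
    carrier H g -> a _ (tagged v) g <> tagged v ->
    fidx (proj_rist (carrier H) (tagged v) (a _ (tagged v) g))
      (ray_rist a (tagged v))}.
  have ae1 (v : {n & vertex d n}) g : {ae mu, forall H : SubBorel G,
      carrier H g -> a _ (tagged v) g <> tagged v ->
      fidx (proj_rist (carrier H) (tagged v) (a _ (tagged v) g))
        (ray_rist a (tagged v))}.
    have [ug|ug] := pselect (a _ (tagged v) g = tagged v).
      by apply: aeW => H _.
    have := ae_fidx_proj_rist1 ug.
    by apply: ae_imply => H + Hg _; apply.
  apply: ae_forall_countable => [|v]; first exact: countableP.
  exact: ae_forall_countable.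
apply: ae_imply => H fidxH n u.
exact: (fidxH (existT (fun k => vertex d k : Type) n u)).
Qed.

End ProjectionsOfIRS.

(** * Products of subgroups of rigid stabilizers over a level *)

Section LevelDecomposition.
Variables (d : nat -> nat) (hd : forall j, (2 <= d j)%N).
Variables (G : groupType) (a : tree_action d G) (ha : faithful_action a).
Variable m : nat.
Implicit Types (x y : boundary d) (u v : vertex d m) (f : vertex d m -> G).
Implicit Types (g h b c : G) (K : vertex d m -> set G).

(** The decomposition of [g] in the product of the rigid stabilizers of level [m], stated ray by ray
    so that no order of the factors enters. *)
Definition components g f : Prop := forall u,
  ray_rist a u (f u) /\
  forall x, ray_prefix x m = u -> ray_act a x g = ray_act a x (f u).

Lemma ray_act_prod f (r : seq (vertex d m)) x :
  (forall u, ray_rist a u (f u)) -> uniq r ->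
  ray_act a x (\prod_(u <- r) f u) =
    if ray_prefix x m \in r then ray_act a x (f (ray_prefix x m)) else x.
Proof.
move=> fR; elim: r x => [|u r IHr] x; first by rewrite big_nil ray_act1.
move=> /= /andP[ur ru]; rewrite big_cons ray_actM IHr // inE.
have [xu|xu] := eqVneq (ray_prefix x m) u.
  by rewrite (ray_rist_prefix (fR u) xu) (negPf ur) /= xu.
by rewrite fR //; exact/eqP.
Qed.

Lemma components_prod f :
  (forall u, ray_rist a u (f u)) -> components (\prod_u f u) f.
Proof.
move=> fR u; split=> // x xu.
by rewrite ray_act_prod ?index_enum_uniq // mem_index_enum xu.
Qed.

Lemma components_eq g h f : components g f -> components h f -> g = h.
Proof.
move=> gf hf; apply: (eq_ray_act hd ha) => x.
by rewrite ((gf (ray_prefix x m)).2 x erefl) ((hf (ray_prefix x m)).2 x erefl).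
Qed.

Lemma components1 : components 1 (fun=> 1).
Proof. by move=> u; split=> //; exact: ray_rist1. Qed.

Lemma componentsV g f : components g f -> components g^-1 (fun u => (f u)^-1).
Proof.
move=> gf u; have [fu gfu] := gf u; split; first exact: ray_ristV.
move=> x xu; have xfu := ray_rist_prefix (ray_ristV fu) xu.
by rewrite -{1}[x](ray_actKV a x (f u)) -gfu // ray_actK.
Qed.

Lemma componentsM g h f f' : components g f -> components h f' ->
  components (g * h) (fun u => f u * f' u).
Proof.
move=> gf hf' u; have [fu gfu] := gf u; have [f'u hf'u] := hf' u.
split; first exact: ray_ristM.
move=> x xu; rewrite !ray_actM gfu // hf'u //.
exact: ray_rist_prefix xu.
Qed.

Lemma components_prefix g f x :
  components g f -> ray_prefix (ray_act a x g) m = ray_prefix x m.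
Proof.
move=> gf; have [fu ->] := gf (ray_prefix x m); last by [].
exact: ray_rist_prefix fu _.
Qed.

Definition level_product K : set G :=
  [set g | exists2 f, components g f & forall u, K u (f u)].

Lemma subgp_level_product K :
  (forall u, subgp (K u)) -> subgp (level_product K).
Proof.
move=> sgK; split=> [|g h [f gf Kf] [f' hf' Kf']].
  by exists (fun=> 1) => [|u]; [exact: components1 | exact: (sgK u).1].
exists (fun u => f u * (f' u)^-1) => [|u].
  exact: componentsM gf (componentsV hf').
exact: (sgK u).2.
Qed.

Hypothesis hbr : branch_group a.

Lemma fidx_level_rist : fidx (level_product (ray_rist a (n:=m))) [set: G].
Proof.
have [_ _ /(_ m) fiR] := hbr.
apply: fidxS (finite_index_fidx _ fiR) => //.
  move=> g [f [fR ->]]; exists f; last by move=> u; exact/Rist_ray_rist/fR.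
  by apply: components_prod => u; exact/Rist_ray_rist/fR.
exists (fun=> 1); split=> [u n v _|]; first exact: vact1.
by rewrite big1.
Qed.

Lemma fidx_level_product K :
  (forall u, fidx (K u) (ray_rist a u)) -> fidx (level_product K) [set: G].
Proof.
move=> iK; apply: fidx_trans fidx_level_rist.
have iK' u : exists (T : finType) (q : G -> T), forall g h,
    ray_rist a u g -> ray_rist a u h -> q g = q h -> K u (g * h^-1) := iK u.
pose T u := projT1 (cid (iK' u)).
pose q u : G -> T u := projT1 (cid (projT2 (cid (iK' u)))).
have qP u := projT2 (cid (projT2 (cid (iK' u)))).
have /choice[F FP] g : exists f,
    level_product (ray_rist a (n:=m)) g -> components g f.
  have [[f gf _]|ng] := pselect (level_product (ray_rist a (n:=m)) g).
    by exists f.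
  by exists (fun=> 1).
exists {dffun forall u, T u}, (fun g => [ffun u => q u (F g u)]) => g h Rg Rh.
move=> /ffunP qgh; exists (fun u => F g u * (F h u)^-1).
  by apply: componentsM (FP g Rg) (componentsV (FP h Rh)).
move=> u; apply: (qP u).
- by have [] := FP g Rg u.
- by have [] := FP h Rh u.
- by move: (qgh u); rewrite !ffunE.
Qed.

(* The orbits of a finite index subgroup of a rigid stabilizer are infinite,
   since the tree has arbitrarily large levels on which the group is
   transitive. *)
Lemma fidx_rist_moves u (K : set G) x : fidx K (ray_rist a u) ->
  ray_prefix x m = u -> exists2 k, K k & ray_act a x k <> x.
Proof.
move=> iK xu; apply: contrapT => nK.
have Kx k : K k -> ray_act a x k = x.
  by move=> Kk; apply: contrapT => xk; apply: nK; exists k.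
(* Only the component at [u] is constrained. If [K] fixed [x], the stabilizer of [x] would contain
   this level product and have finite index in [G]. *)
pose K' v := if v == u then K else setT.
have : fidx [set g | ray_act a x g = x] [set: G].
  apply: fidxS (fidx_level_product (K := K') _) => //.
    move=> g [f gf Kf] /=; rewrite ((gf u).2 x xu); apply: Kx.
    by have := Kf u; rewrite /K' eqxx.
  move=> v; rewrite /K'; case: eqP => [->//|_].
  by exists unit, (fun=> tt).
case=> T [f fP].
have [tr _ _] := hbr.
(* Level [n] has more than [n] vertices; elements carrying the prefix of [x] to different ones lie
   in different cosets of the stabilizer of [x], hence have different labels. *)
pose n := #|T|.
have /choice[t tP] (v : vertex d n) : exists g, a n (ray_prefix x n) g = v.
  exact: tr.
have inj_ft : injective (f \o t).
  move=> v w /= ftvw; rewrite -(tP v) -(tP w) -!ray_prefix_act.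
  suff -> : ray_act a x (t v) = ray_act a x (t w) by [].
  have /= xvw := fP (t v) (t w) I I ftvw.
  by rewrite -{2}xvw ray_actM ray_actKV.
have := leq_card _ inj_ft.
by rewrite leqNgt card_vertex.
Qed.

End LevelDecomposition.

(** * Vertices whose orbit has three points *)

Section ThreePointOrbits.
Variables (d : nat -> nat) (hd : forall j, (2 <= d j)%N).
Variables (G : groupType) (a : tree_action d G) (ha : faithful_action a).
Variables (H : set G) (sgH : subgp H).
Implicit Types (x y : boundary d) (g h b c : G).

Definition three_orbit n (u : vertex d n) : Prop := exists g h,
  [/\ H g, H h, a n u g <> u, a n u h <> u & a n u g <> a n u h].

Lemma three_orbit_leq n m x : (n <= m)%N ->
  three_orbit (ray_prefix x n) -> three_orbit (ray_prefix x m).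
Proof.
move=> le_nm [g [h [Hg Hh]]]; rewrite -!ray_prefix_act => xg xh xgh.
exists g, h; rewrite -!ray_prefix_act; split=> // /(eq_ray_prefix le_nm) //.
Qed.

Lemma Fix_not_three_orbit n x : Fix a H x -> ~ three_orbit (ray_prefix x n).
Proof.
by move=> Fx [g [h [Hg Hh]]]; rewrite -ray_prefix_act Fx.
Qed.

Lemma neq_ray_prefix x y : x <> y -> exists n, ray_prefix x n <> ray_prefix y n.
Proof.
move=> xy; apply: contrapT => nxy; apply: xy; apply: eq_ray => n.
by apply: contrapT => xyn; apply: nxy; exists n.
Qed.

Lemma subgp_proj_rist n (u v : vertex d n) :
  u <> v -> subgp (proj_rist a H u v).
Proof.
move=> uv; have sgu := subgp_ray_rist a u; have sgv := subgp_ray_rist a v.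
split=> [|x y [ux [b vb Hxb]] [uy [c vc Hyc]]].
  split; first exact: sgu.1.
  by exists 1; [exact: sgv.1 | rewrite mulg1; exact: sgH.1].
split; first exact: sgu.2.
exists (b * c^-1); first exact: sgv.2.
have := sgH.2 _ _ Hxb Hyc; congr (H _).
have yb : b * c^-1 * y^-1 = y^-1 * (b * c^-1).
  apply/esym/(ray_rist_commute hd ha uv); first exact: (subgpV sgu).
  exact: sgv.2.
by rewrite -[RHS]mulgA -yb invgM !mulgA.
Qed.

(** The group [K_u] of the opening sketch. Using every other point [v] of the orbit avoids a choice,
    which makes it equivariant under conjugation and measurable in [H]. *)
Definition rist_core n (u : vertex d n) : set G :=
  [set x | ray_rist a u x /\
    forall v, (exists2 h, H h & a n u h = v) -> v <> u -> proj_rist a H u v x].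

Lemma subgp_rist_core n (u : vertex d n) : subgp (rist_core u).
Proof.
have sgu := subgp_ray_rist a u; split=> [|x y [ux px] [uy py]].
  split=> [|v uv vu]; first exact: sgu.1.
  by apply: (subgp_proj_rist _).1; exact/nesym.
split=> [|v uv vu]; first exact: sgu.2.
by apply: (subgp_proj_rist _).2; [exact/nesym | exact: px | exact: py].
Qed.

(** Complete [b] by [k] below [u g] and [c] by [l] below [u h] to elements of [H]. The three
    supports are disjoint, so [k] and [l] cancel from the commutator. *)
Lemma rist_core_commutator n (u : vertex d n) b c : three_orbit u ->
  rist_core u b -> rist_core u c -> H (b * c * (c * b)^-1).
Proof.
move=> [g [h [Hg Hh ug uh ugh]]] [ub pb] [uc pc].
have [||_ [k vk Hbk]] := pb (a n u g); [by exists g | by [] |].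
have [||_ [l wl Hcl]] := pc (a n u h); [by exists h | by [] |].
have := sgH.2 _ _ (subgpM sgH Hbk Hcl) (subgpM sgH Hcl Hbk).
have kc : k * c = c * k.
  by apply: (ray_rist_commute hd ha ug vk uc).
have lb : l * b = b * l by apply: (ray_rist_commute hd ha uh wl ub).
have kl : k * l = l * k by apply: (ray_rist_commute hd ha ugh vk wl).
have -> : b * k * (c * l) = b * c * (k * l).
  by rewrite -mulgA (mulgA k) kc -!mulgA.
have -> : c * l * (b * k) = c * b * (k * l).
  by rewrite -mulgA (mulgA l) lb kl -!mulgA.
by rewrite !gnorm.
Qed.

Hypothesis fiH : forall n (u : vertex d n) g, H g -> a n u g <> u ->
  fidx (proj_rist a H u (a n u g)) (ray_rist a u).

Lemma fidx_rist_core n (u : vertex d n) : fidx (rist_core u) (ray_rist a u).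
Proof.
have fiR : fidx (ray_rist a u) (ray_rist a u).
  exists unit, (fun=> tt) => x y ux uy _.
  exact: (subgp_ray_rist a u).2.
pose S v := [set x |
  (exists2 h, H h & a n u h = v) -> v <> u -> proj_rist a H u v x].
suff iS : fidx [set x | forall v, S v x] (ray_rist a u).
  by apply: fidxS (fidxI fiR iS) => // x [].
apply: fidx_bigcap => v.
have [[[h Hh <-] uh]|nuv] := pselect ((exists2 h, H h & a n u h = v) /\ v <> u).
  by apply: fidxS (fiH Hh uh) => // x px _ _.
by exists unit, (fun=> tt) => x y _ _ _ uv vu; case: nuv.
Qed.

Hypothesis hbr : branch_group a.

(** If [h] moves the prefix [u] of [x], some [k] in the projection of [H] moves [x] below [u], and
    its completion [k * b] in [H] acts on [x] as [k]. The rays [x], [x k] and [x h] are distinct: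
    the first two pass through [u], the last does not. *)
Lemma three_orbit_moved x : ~ Fix a H x -> exists n, three_orbit (ray_prefix x n).
Proof.
move=> /existsNP[h /not_implyP[Hh /neq_ray_prefix[n]]].
rewrite ray_prefix_act; set u := ray_prefix x n => uh.
have [k [uk [b vb Hkb]] xk] := fidx_rist_moves hd hbr (fiH Hh uh) erefl.
have [n' xkn'] := neq_ray_prefix xk.
have xku : ray_prefix (ray_act a x k) n = u by exact: ray_rist_prefix.
have xkb : ray_act a x (k * b) = ray_act a x k.
  by rewrite ray_actM vb // xku => /esym.
exists (maxn n n'), (k * b), h; rewrite -!ray_prefix_act xkb; split=> //.
- by move=> /(eq_ray_prefix (leq_maxr n n')).
- by move=> /(eq_ray_prefix (leq_maxl n n')); rewrite ray_prefix_act.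
move=> /(eq_ray_prefix (leq_maxl n n')); rewrite xku ray_prefix_act.
by move=> /esym.
Qed.

Definition resolves m : Prop :=
  forall x, Fix a H x \/ three_orbit (ray_prefix x m).

Lemma open_ray_prefix m (P : vertex d m -> Prop) :
  open [set x : boundary d | P (ray_prefix x m)].
Proof.
have cyl n (u : vertex d n) : open [set x : boundary d | ray_prefix x n = u].
  rewrite openE => x /= xu; apply: (@filterS _ _ _ [set y : boundary d |
      forall i : 'I_n, (y i : 'I_(d i)) = u i]).
    by move=> y yu; apply/ffunP => i; rewrite ffunE.
  apply: (@filter_forall _ _ (fun i : 'I_n =>
    [set y : boundary d | (y i : 'I_(d i)) = u i]) (nbhs x)) => i.
  have := @proj_continuous _ (fun j => discrete_topology 'I_(d j)) i x.
  move=> /(_ [set z | z = u i]); apply.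
  have -> : [set z | z = u i] = [set x i].
    by rewrite -xu ffunE.
  exact: discrete_set1.
rewrite (_ : mkset _ = \bigcup_(u in [set u | P u])
    [set x : boundary d | ray_prefix x m = u]).
  by apply: bigcup_open => u _; exact: cyl.
by apply/seteqP; split=> [x Px|x [u Pu /= ->]]//; exists (ray_prefix x m).
Qed.

End ThreePointOrbits.

Lemma boundary_compact (d : nat -> nat) : compact [set: boundary d].
Proof.
have fin_discrete j : compact [set: discrete_topology 'I_(d j)].
  exact/finite_compact/finite_finset.
have := tychonoff fin_discrete; set A := (X in compact X -> _).
by suff -> : A = [set: boundary d] by []; apply/seteqP; split.
Qed.

(** * A single level for all moved rays, and the core subgroup *)

Section Resolution.
Variables (d : nat -> nat) (hd : forall j, (2 <= d j)%N).
Variables (G : groupType) (a : tree_action d G) (ha : faithful_action a).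
Hypothesis hbr : branch_group a.
Variables (H : set G) (sgH : subgp H).
Hypothesis fiH : forall n (u : vertex d n) g, H g -> a n u g <> u ->
  fidx (proj_rist a H u (a n u g)) (ray_rist a u).
Implicit Types (x y : boundary d) (g h b c : G).

(** Counterexamples [z m] at every level cluster at some [x]. Since [Fix a H] is open, [x] is moved,
    so a prefix of [x] has a three-point orbit; then so does that prefix of some later [z k],
    against the choice of [z k]. *)
Lemma clopen_resolves : clopen (Fix a H) -> exists m, resolves a H m.
Proof.
move=> [oF _]; apply: contrapT => nres.
have /choice[z zP] m : exists x, ~ Fix a H x /\ ~ three_orbit a H (ray_prefix x m).
  apply: contrapT => nx; apply: nres; exists m => x.
  have [|nFx] := pselect (Fix a H x); first by left.
  right; apply: contrapT => n3; apply: nx; exists x; split=> //.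
have [x [_ xz]] := @boundary_compact d (z @ \oo) _ filterT.
have nFx : ~ Fix a H x.
  move=> Fx; have nbF : nbhs x (Fix a H) by apply: open_nbhs_nbhs.
  have [|y [/= zy Fy]] := xz (z @` setT) (Fix a H) _ nbF.
    by exists 0%N => // k _; exists k.
  by case: zy => k _ zk; apply: (zP k).1; rewrite zk.
have [n x3] := three_orbit_moved hd fiH hbr nFx.
have oU := @open_ray_prefix d n (three_orbit a H (n:=n)).
have nbU := open_nbhs_nbhs (conj oU x3).
have [|y [/= zy y3]] := xz (z @` [set k | (n <= k)%N]) _ _ nbU.
  by exists n => // k /= le_nk; exists k.
case: zy => k /= le_nk zk; apply: (zP k).2; rewrite zk.
exact: three_orbit_leq y3.
Qed.

Variable m : nat.
Hypothesis resH : resolves a H m.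

Definition big_core : set G := level_product a (rist_core a H (n:=m)).

Lemma subgp_big_core : subgp big_core.
Proof. by apply: subgp_level_product => u; exact: subgp_rist_core. Qed.

Lemma fidx_big_core : fidx big_core [set: G].
Proof. by apply: fidx_level_product => // u; exact: fidx_rist_core. Qed.

(* Agreement with elements of [H] away from the fixed cylinders. *)
Definition moved_product : set G :=
  level_product a (m := m) (fun u => [set g | three_orbit a H u -> H g]).

Lemma subgp_moved_product : subgp moved_product.
Proof.
apply: subgp_level_product => u; split=> [_|x y Hx Hy u3]; first exact: sgH.1.
by apply: sgH.2; [exact: Hx | exact: Hy].
Qed.

Lemma big_core_commutator b c :
  big_core b -> big_core c -> moved_product (b * c * (c * b)^-1).
Proof.
move=> [f bf Kf] [f' cf' Kf'].
exists (fun u => f u * f' u * (f' u * f u)^-1) => [|u u3].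
  by do ?[apply: componentsM | apply: (componentsV (f := fun u => f' u * f u))].
exact: (rist_core_commutator hd ha sgH u3 (Kf u) (Kf' u)).
Qed.

(** Write [g] as the product of its components. Those at vertices with a three-point orbit are in
    [H]; at any other vertex every ray below is in [Fix a H], so the component is trivial. *)
Lemma moved_product_pstab g : moved_product g -> pstab a (Fix a H) g -> H g.
Proof.
move=> [f gf Hf] Fg.
have fR u : ray_rist a u (f u) by have [] := gf u.
have -> : g = \prod_u f u := components_eq hd ha gf (components_prod fR).
apply: (big_ind H) => [|x y|u _]; [exact: sgH.1 | exact: subgpM |].
have [/Hf//|nu3] := pselect (three_orbit a H u).
suff -> : f u = 1 by exact: sgH.1.
apply: (eq_ray_act hd ha) => x; rewrite ray_act1.
have [xu|] := pselect (ray_prefix x m = u); last exact: fR.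
rewrite -(gf u).2 //; apply: Fg.
by have [//|] := resH x; rewrite xu.
Qed.

Lemma big_core_normalizes b c :
  big_core b -> (H `&` big_core) c -> (H `&` big_core) (b * c * b^-1).
Proof.
move=> Bb [Hc Bc]; have sgB := subgp_big_core.
split; last by apply: sgB.2 => //; exact: (subgpM sgB).
suff Hbc : H (b * c * (c * b)^-1).
  by have := subgpM sgH Hbc Hc; rewrite !gnorm.
apply: moved_product_pstab; first exact: big_core_commutator.
move=> y Fy; rewrite invgM mulgA !ray_actM.
(* [b] preserves prefixes of length [m], and the prefix of a fixed ray has no three-point orbit, so
   [resH] puts the image of [y] back in [Fix a H]. *)
suff Fyb : Fix a H (ray_act a y b).
  by rewrite (Fyb c Hc) ray_actK; apply: Fy; exact: subgpV.
have [//|] := resH (ray_act a y b).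
have [f bf _] := Bb; rewrite (components_prefix y bf).
by move=> /(Fix_not_three_orbit Fy).
Qed.

Lemma fidx_cap_big_core : fidx (H `&` big_core) H.
Proof.
apply: fidxI; last by apply: fidxS fidx_big_core.
by exists unit, (fun=> tt) => x y Hx Hy _; exact: sgH.2.
Qed.

End Resolution.

(** * Equivariance and measurability of the core subgroup *)

Section Equivariance.
Variables (d : nat -> nat) (G : groupType) (a : tree_action d G).
Implicit Types (H : SubBorel G) (g h b c : G).

Lemma conj_subM g h (H : subgroup_space G) :
  conj_sub h (conj_sub g H) = conj_sub (g * h) H.
Proof.
by apply: eq_carrier => x; rewrite !conj_subE invgM !mulgA.
Qed.

Lemma conj_sub1 (H : subgroup_space G) : conj_sub 1 H = H.
Proof. by apply: eq_carrier => x; rewrite conj_subE !gnorm. Qed.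

Lemma conj_sub_mem g H b : carrier H b -> carrier (conj_sub g H) (g^-1 * b * g).
Proof. by move=> Hb; apply/conj_subE; rewrite !gnorm. Qed.

Lemma proj_rist_conj g H n (u v : vertex d n) b :
  proj_rist a (carrier H) u v b ->
  proj_rist a (carrier (conj_sub g H)) (a n u g) (a n v g) (g^-1 * b * g).
Proof.
move=> [ub [c vc Hbc]]; split; first exact: ray_ristJ.
exists (g^-1 * c * g); first exact: ray_ristJ.
by have := conj_sub_mem g Hbc; rewrite !gnorm.
Qed.

Lemma rist_core_conj g H n (u : vertex d n) b :
  rist_core a (carrier H) u b ->
  rist_core a (carrier (conj_sub g H)) (a n u g) (g^-1 * b * g).
Proof.
move=> [ub pb]; split=> [|v [h /conj_subE Hh uv] vu]; first exact: ray_ristJ.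
rewrite -[v](vact1 a) -(mulVg g) vactM; apply/proj_rist_conj/pb.
  by exists (g * h * g^-1); rewrite // !vactM uv.
by move=> vgu; apply: vu; rewrite -vgu -vactM mulVg vact1.
Qed.

Lemma components_conj m g b (f : vertex d m -> G) : components a b f ->
  components a (g^-1 * b * g) (fun u => g^-1 * f (a m u g^-1) * g).
Proof.
move=> bf u; split.
  have [fu _] := bf (a m u g^-1).
  by have := ray_ristJ (h := g) fu; rewrite -vactM mulVg vact1.
move=> x xu; rewrite !ray_actM.
by rewrite (bf (a m u g^-1)).2 // ray_prefix_act xu.
Qed.

Lemma big_core_conj m g H b : big_core a (carrier H) m b ->
  big_core a (carrier (conj_sub g H)) m (g^-1 * b * g).
Proof.
move=> [f bf Kf]; exists (fun u => g^-1 * f (a m u g^-1) * g) => [|u].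
  exact: components_conj.
have := rist_core_conj g (Kf (a m u g^-1)).
by rewrite -vactM mulVg vact1.
Qed.

Definition core_part m H : set G := carrier H `&` big_core a (carrier H) m.

Lemma core_part_conj m g H b :
  core_part m (conj_sub g H) b <-> core_part m H (g * b * g^-1).
Proof.
split=> [[Hb Bb]|[Hb Bb]].
  split; first exact/conj_subE.
  have := big_core_conj g^-1 Bb.
  by rewrite conj_subM mulgV conj_sub1 invgK.
split; first exact/conj_subE.
by have := big_core_conj g Bb; rewrite !gnorm.
Qed.

(** Trades the choice of a function for one existential over [G] per vertex, the form used for
    measurability. *)
Lemma level_productP m (K : vertex d m -> set G) g :
  level_product a K g <-> forall u, exists k,
    (ray_rist a u k /\
     forall x, ray_prefix x m = u -> ray_act a x g = ray_act a x k) /\ K u k.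
Proof.
split=> [[f gf Kf] u|/choice[f fP]]; first by exists (f u).
by exists f => u; have [] := fP u.
Qed.

Hypothesis hG : countable [set: G].

Lemma measurable_rist_core n (u : vertex d n) b :
  measurable [set H : SubBorel G | rist_core a (carrier H) u b].
Proof.
apply: measurable_predI; first exact: measurable_pred_cst.
apply: measurable_pred_forall => [|v]; first exact: countableP.
apply: measurable_pred_imply.
  apply: measurable_pred_exists2 => // h; first exact: measurable_carrier.
  exact: measurable_pred_cst.
apply: measurable_pred_imply; first exact: measurable_pred_cst.
apply: measurable_predI; first exact: measurable_pred_cst.
apply: measurable_pred_exists2 => // c; first exact: measurable_pred_cst.
exact: measurable_carrier.
Qed.

Lemma measurable_core_part m b :
  measurable [set H : SubBorel G | core_part m H b].
Proof.
apply: measurable_predI; first exact: measurable_carrier.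
rewrite (_ : mkset _ = [set H : SubBorel G | forall u : vertex d m, exists k,
    (ray_rist a u k /\
     forall x, ray_prefix x m = u -> ray_act a x b = ray_act a x k) /\
    rist_core a (carrier H) u k]); last first.
  by apply/seteqP; split=> H /level_productP.
apply: measurable_pred_forall => [|u]; first exact: countableP.
apply: measurable_pred_exists => // k.
(* The quantifier over rays is uncountable, but its condition does not involve [H]. *)
apply: measurable_predI; first exact: measurable_pred_cst.
exact: measurable_rist_core.
Qed.

End Equivariance.

(** * Ergodicity and a criterion for atomicity *)

Section Ergodicity.
Variables (G : groupType) (hG : countable [set: G]) (R : realType).
Variables (mu : probability (SubBorel G) R) (herg : conj_ergodic mu).

Lemma ergodic_constant (P : SubBorel G -> Prop) :
  measurable [set H | P H] -> (forall g H, P (conj_sub g H) <-> P H) ->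
  exists b : Prop, {ae mu, forall H : SubBorel G, P H <-> b}.
Proof.
move=> mP PJ; have [|P0|P1] := herg mP.
- by move=> g; apply/seteqP; split=> H /= PH; exact/(PJ g H).
- exists False; exists [set H | P H]; split=> // H /= nP.
  by apply: contrapT => nPH; apply: nP; split.
exists True; exists (~` [set H | P H]); split; first exact: measurableC.
  by rewrite probability_setC // P1 subee.
by move=> H /= nP PH; apply: nP.
Qed.

Lemma measurable_set1_subgroup (H : SubBorel G) : measurable [set H].
Proof.
rewrite (_ : [set H] = [set K : SubBorel G |
    forall g, carrier K g <-> carrier H g]).
  apply: measurable_pred_forall => // g; apply: measurable_pred_iff.
  exact: measurable_carrier.
apply/seteqP; split=> [K -> //|K /= KH].
exact: eq_carrier.
Qed.

(** Among countably many candidate subgroups, those of mass zero together form a null set. *)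
Lemma atomic_of_countable (I : Type) (Q : I -> set G) :
  countable [set: I] ->
  {ae mu, forall H : SubBorel G, exists i, forall x, carrier H x <-> Q i x} ->
  atomic mu.
Proof.
move=> cI aeQ.
have : {ae mu, forall H : SubBorel G, forall i,
    (forall x, carrier H x <-> Q i x) -> (0 < mu [set H])%E}.
  apply: ae_forall_countable => // i.
  have [[K KQ]|nK] :=
      pselect (exists K : SubBorel G, forall x, carrier K x <-> Q i x);
    last by apply: aeW => H HQ; case: nK; exists H.
  have eqK (H : SubBorel G) : (forall x, carrier H x <-> Q i x) -> H = K.
    by move=> HQ; apply: eq_carrier => x; rewrite HQ KQ.
  have [K0|Kpos] := pselect (mu [set K] = 0%E).
    exists [set K]; split=> //; first exact: measurable_set1_subgroup.
    by move=> H /= /not_implyP[/eqK].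
  apply: aeW => H /eqK ->; rewrite lt_neqAle measure_ge0 andbT eq_sym.
  exact/eqP.
by apply: filterS2 aeQ => H [i HQ]; apply.
Qed.

End Ergodicity.

Lemma fidx_cosets (G : groupType) (K H : set G) : fidx K H ->
  exists2 s : seq G, (forall t, t \in s -> H t) &
    forall x, H x -> exists2 t, t \in s & K (x * t^-1).
Proof.
move=> [T [f fK]].
(* [None] marks the labels not attained on [H], so that all listed representatives lie in [H]. *)
have /choice[r rP] t : exists r : option G,
    if r is Some y then H y /\ f y = t else forall y, H y -> f y <> t.
  have [[y Hy]|ny] := pselect (exists y, H y /\ f y = t); first by exists (Some y).
  by exists None => y Hy fy; apply: ny; exists y.
exists (pmap r (enum T)) => [t|x Hx].
  by rewrite mem_pmap => /mapP[z _ rz]; have := rP z; rewrite -rz => -[].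
have := rP (f x); case rfx: (r (f x)) => [t|]; last by move=> /(_ x Hx).
move=> [Ht ft]; exists t; last exact: fK.
by rewrite mem_pmap -rfx map_f // mem_enum.
Qed.

(** * Atomicity of the measure *)

Section Atomicity.
Variables (d : nat -> nat) (hd : forall j, (2 <= d j)%N).
Variables (G : groupType) (hG : countable [set: G]).
Variables (a : tree_action d G) (ha : faithful_action a) (hbr : branch_group a).
Variables (R : realType) (mu : probability (SubBorel G) R).
Hypotheses (hirs : is_IRS mu) (herg : conj_ergodic mu).
Hypothesis hfix : {ae mu, forall H : SubBorel G, clopen (Fix a (carrier H))}.

Definition proj_finite_index (H : SubBorel G) : Prop :=
  forall n (u : vertex d n) g, carrier H g -> a n u g <> u ->
    fidx (proj_rist a (carrier H) u (a n u g)) (ray_rist a u).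

Lemma ae_resolves : {ae mu, forall H : SubBorel G,
  proj_finite_index H /\ exists m, resolves a (carrier H) m}.
Proof.
apply: filterS2 (ae_fidx_proj_rist hd hG ha hirs) hfix => H fiH cH; split=> //.
exact: clopen_resolves.
Qed.

(** The finite index subgroup [big_core] normalizes [core_part], so the conjugate by [g] depends
    only on the label of [g]. *)
Lemma core_part_finite_orbit m (H : SubBorel G) :
  proj_finite_index H -> resolves a (carrier H) m ->
  exists (T : finType) (r : T -> G), forall g, exists t, forall x,
    core_part a m H (g * x * g^-1) <-> core_part a m H (r t * x * (r t)^-1).
Proof.
move=> fiH resH; have sgH := subgp_carrier H.
have [T [f fB]] := fidx_big_core hbr fiH m.
have /choice[r rP] t : exists r, (exists g, f g = t) -> f r = t.
  have [[g gt]|ng] := pselect (exists g, f g = t); first by exists g.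
  by exists 1.
exists T, r => g; exists (f g) => x.
have frg : f (r (f g)) = f g by apply: rP; exists g.
move: (r _) frg => h fhg.
have norm := big_core_normalizes hd ha sgH resH.
split=> [Dg|Dh].
  by have := norm _ _ (fB h g I I fhg) Dg; rewrite !gnorm.
by have := norm _ _ (fB g h I I (esym fhg)) Dh; rewrite !gnorm.
Qed.

Lemma irs_atomic : atomic mu.
Proof.
have [e eP] := countable_enum hG.
(* [meets (m, c) H]: some conjugate of [core_part a m H] lies in the basic
   clopen set of subsets prescribed by [c]. *)
pose meets (i : nat * seq (nat * bool)) (H : SubBorel G) := exists g,
  forall p, p \in i.2 -> (core_part a i.1 H (g * e p.1 * g^-1) <-> p.2).
have /choice[b bP] i : exists b : Prop, {ae mu, forall H, meets i H <-> b}.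
  apply: ergodic_constant => //.
    apply: measurable_pred_exists => // g.
    apply: measurable_pred_forall => [|p]; first exact: countableP.
    apply: measurable_pred_imply; first exact: measurable_pred_cst.
    by apply: measurable_pred_iff; exact: measurable_core_part.
  move=> h H; split=> -[g gP].
    by exists (h * g) => p /gP; rewrite core_part_conj invgM !mulgA.
  by exists (h^-1 * g) => p /gP; rewrite core_part_conj invgM !gnorm.
pose good m (H : SubBorel G) :=
  [/\ proj_finite_index H, resolves a (carrier H) m & forall i, meets i H <-> b i].
have aegood : {ae mu, forall H : SubBorel G, exists m, good m H}.
  have aeb : {ae mu, forall H : SubBorel G, forall i, meets i H <-> b i}.
    by apply: ae_forall_countable => //; exact: countableP.
  by apply: filterS2 ae_resolves aeb => H [fiH [m mH]] bH; exists m.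
(* One model subgroup per level; every good [H] at level [m] meets the same basic sets as [K m]. The
   default [point] serves levels without good subgroups. *)
have /choice[K KP] m : exists K, forall H, good m H -> good m K.
  have [[K gK]|nK] := pselect (exists K, good m K); first by exists K.
  by exists (point : SubBorel G) => H gH; case: nK; exists H.
(* The countable family: finite unions of cosets of a conjugate of [core_part a m (K m)], indexed by
   the level, the conjugating element and the representatives. *)
pose Q (i : nat * nat * seq nat) := [set x | exists2 k, k \in i.2 &
  core_part a i.1.1 (K i.1.1) (e i.1.2 * (x * (e k)^-1) * (e i.1.2)^-1)].
apply: (@atomic_of_countable _ hG _ _ _ Q); first exact: countableP.
apply: ae_imply aegood => H [m gH].
have [fiH resH bH] := gH; have [fiK resK bK] := KP m H gH.
have [g gP] : exists g, forall x,
    core_part a m H x <-> core_part a m (K m) (g * x * g^-1).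
  have [T [r rP]] := core_part_finite_orbit fiK resK.
  (* Otherwise each of the finitely many conjugates differs from the core part of [H] at some
     [e (z t)]. The finite pattern [c] of [H] at these points is met by [K m] too, through a
     conjugate equal to one of the listed ones, a contradiction. *)
  apply: contrapT => ng.
  have /choice[z zP] t : exists n, ~ (core_part a m H (e n) <->
      core_part a m (K m) (r t * e n * (r t)^-1)).
    apply: contrapT => nt; apply: ng; exists (r t) => x.
    have [n <-] := eP x; apply: contrapT => nn; apply: nt; by exists n.
  pose c := [seq (z t, `[< core_part a m H (e (z t)) >]) | t <- enum T].
  have : meets (m, c) (K m).
    apply/bK/bH; exists 1 => p /mapP[t _ -> /=].
    by rewrite !gnorm; split=> [/asboolP|/asboolP].
  move=> [g gP]; have [t tP] := rP g; apply: (zP t).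
  have /= ct := gP (z t, `[< core_part a m H (e (z t)) >]) _.
  rewrite -tP; split=> [HD|KD].
    by apply/ct; [apply/mapP; exists t; rewrite ?mem_enum | apply/asboolP].
  by apply/asboolP/ct => //; apply/mapP; exists t; rewrite ?mem_enum.
have sgH := subgp_carrier H.
have [s sH sD] := fidx_cosets (fidx_cap_big_core hbr sgH fiH m).
have [n nP] := eP g.
have /choice[q qP] := eP.
exists (m, n, map q s) => x; rewrite /Q /= nP.
split=> [Hx|[_ /mapP[t ts ->]]].
  have [t ts Dt] := sD x Hx; exists (q t); first exact: map_f.
  by rewrite qP; apply/gP.
rewrite qP => /gP[Hxt _].
by have := subgpM sgH Hxt (sH t ts); rewrite !gnorm.
Qed.

End Atomicity.

(** * Normal cores and derived subgroups in just infinite groups *)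

Section JustInfinite.
Variable G : groupType.
Implicit Types (S B : set G) (g h x : G).

Definition normal_core B : set G := [set x | forall g, B (g * x * g^-1)].

Lemma subgp_normal_core B : subgp B -> subgp (normal_core B).
Proof.
move=> [B1 BF]; split=> [g|x y Bx By g]; first by rewrite !gnorm.
by have := BF _ _ (Bx g) (By g); rewrite !gnorm.
Qed.

Lemma normal_coreJ B g x : normal_core B x -> normal_core B (g * x * g^-1).
Proof. by move=> Bx h; have := Bx (h * g); rewrite !gnorm. Qed.

Lemma fidx_normal_core B :
  subgp B -> fidx B [set: G] -> fidx (normal_core B) [set: G].
Proof.
move=> sgB [T [f fB]].
have /choice[r rP] t : exists r, (exists g, f g = t) -> f r = t.
  have [[g gt]|ng] := pselect (exists g, f g = t); first by exists g.
  by exists 1.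
(* The label of [x] records how right multiplication by [x] acts on the cosets of [B], through the
   representatives [r t]. *)
exists {ffun T -> T}, (fun x => [ffun t => f (r t * x)]) => x y _ _ /ffunP fxy g.
have := fB _ _ I I (etrans (esym (ffunE _ _)) (etrans (fxy (f g)) (ffunE _ _))).
have frg : f (r (f g)) = f g by apply: rP; exists g.
move: (r _) frg => h fhg.
have Bgh := fB g h I I (esym fhg).
move=> Bxy; have := subgpM sgB (subgpM sgB Bgh Bxy) (subgpV sgB Bgh).
by rewrite !gnorm.
Qed.

(** The subgroup generated by the commutators of [S], as an intersection: inclusion in a subgroup
    [D] is then checked on commutators alone. *)
Definition derived S : set G := [set x | forall D, subgp D ->
  (forall v w, S v -> S w -> D (v * w * (w * v)^-1)) -> D x].

Lemma subgp_derived S : subgp (derived S).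
Proof.
split=> [D sgD _|x y Sx Sy D sgD SD]; first exact: sgD.1.
by apply: sgD.2; [exact: Sx | exact: Sy].
Qed.

Lemma derivedJ S g x : (forall h y, S y -> S (h * y * h^-1)) ->
  derived S x -> derived S (g * x * g^-1).
Proof.
move=> SJ Sx D sgD SD.
apply: (Sx [set y | D (g * y * g^-1)]) => [|v w Sv Sw].
  split=> [|y z /= Dy Dz]; first by rewrite /= !gnorm; exact: sgD.1.
  by have := sgD.2 _ _ Dy Dz; rewrite !gnorm.
by have := SD _ _ (SJ g v Sv) (SJ g w Sw); rewrite /= !gnorm.
Qed.

Lemma subgroup_of S : subgp S -> exists N : subgroup_space G, carrier N = S.
Proof.
move=> [S1 SF].
have sgN : subgroups (fun x : G => `[< S x >]).
  split=> [|x y]; first exact/asboolP.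
  by rewrite !unfold_in => /asboolP Sx /asboolP Sy; apply/asboolP/SF.
exists (SigSub (mem_set sgN)); apply/seteqP.
by split=> x; rewrite /carrier /= => /asboolP.
Qed.

Lemma just_infinite_derived S : just_infinite G ->
  (forall g x, S x -> S (g * x * g^-1)) ->
  (exists v w, [/\ S v, S w & v * w <> w * v]) ->
  fidx (derived S) [set: G].
Proof.
move=> [_ ji] SJ [v [w [Sv Sw vw]]].
have [N NE] := subgroup_of (subgp_derived S).
have fiN : finite_index (carrier N) [set: G].
  apply: ji => [g|N1].
    apply: eq_carrier => x; rewrite conj_subE NE; split; last exact: derivedJ.
    by move=> /(@derivedJ S g^-1 _ SJ); rewrite !gnorm.
  have : derived S (v * w * (w * v)^-1) by move=> D _; apply.
  rewrite -NE N1 => /= /eqP; rewrite divg_eq1 => /eqP; exact: vw.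
rewrite -NE; apply: finite_index_fidx fiN.
exact: (subgp_carrier N).1.
Qed.

End JustInfinite.

(** * Finite index in the pointwise stabilizer *)

Section FiniteIndexInStabilizer.
Variables (d : nat -> nat) (hd : forall j, (2 <= d j)%N).
Variables (G : groupType) (a : tree_action d G) (ha : faithful_action a).
Hypothesis hbr : branch_group a.

(** Let [k] in [W] move a ray [x] already at level [n], and let [w] in [W], supported below the
    prefix of [x] of length [n], move [x]. The conjugate of [w] by [k] is supported elsewhere and
    fixes [x], so it is not [w]. *)
Lemma fidx_noncommuting (W : set G) : subgp W -> fidx W [set: G] ->
  exists v w, [/\ W v, W w & v * w <> w * v].
Proof.
move=> sgW iW.
have iWR n (u : vertex d n) : fidx (W `&` ray_rist a u) (ray_rist a u).
  apply: fidxI; first exact: fidxS iW.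
  exists unit, (fun=> tt) => g h ug uh _; exact: (subgp_ray_rist a u).2.
have /card_gt0P[u0 _] := card_vertex hd 0.
have [x _] := ray_through hd u0.
have [k [Wk _] xk] := fidx_rist_moves hd hbr (iWR 0 _) (erefl (ray_prefix x 0)).
have [n xkn] := neq_ray_prefix xk.
have [w [Ww uw] xw] := fidx_rist_moves hd hbr (iWR n _) (erefl (ray_prefix x n)).
exists k, w; split=> // kw; apply: xw.
have -> : w = k^-1 * w * k by rewrite -mulgA -kw mulKg.
apply: (ray_ristJ uw); rewrite -ray_prefix_act; exact/nesym.
Qed.

Lemma subgp_pstab (K : set (boundary d)) : subgp (pstab a K).
Proof.
split=> [x _|g h Kg Kh x Kx]; first exact: ray_act1.
by rewrite ray_actM Kg // -{1}(Kh x Kx) ray_actK.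
Qed.

Lemma just_infinite_finite_index (H : SubBorel G) :
  just_infinite G -> proj_finite_index a H ->
  (exists m, resolves a (carrier H) m) ->
  finite_index (carrier H) (pstab a (Fix a (carrier H))).
Proof.
move=> ji fiH [m resH]; have sgH := subgp_carrier H.
have sgB : subgp (big_core a (carrier H) m) by exact: subgp_big_core.
have sgW := subgp_normal_core sgB.
have iW := fidx_normal_core sgB (fidx_big_core hbr fiH m).
apply: fidx_finite_index => // [g Hg x Fx|]; first exact: Fx.
set P := pstab _ _; have sgP : subgp P by exact: subgp_pstab.
have iD := just_infinite_derived ji (@normal_coreJ _ _) (fidx_noncommuting sgW iW).
have iPP : fidx P P by exists unit, (fun=> tt) => g h Pg Ph _; exact: sgP.2.
have iDP : fidx (derived (normal_core (big_core a (carrier H) m))) P.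
  by apply: fidxS iD.
(* Commutators of [big_core] lie in the subgroup [moved_product], hence so does the derived
   subgroup; its elements in [P] are then in [H]. *)
apply: fidxS (fidxI iDP iPP) => // g [Dg Pg].
apply: (moved_product_pstab hd ha sgH resH _ Pg).
apply: Dg => [|v w Wv Ww]; first exact: subgp_moved_product.
apply: big_core_commutator => //.
  by have := Wv 1; rewrite !gnorm.
by have := Ww 1; rewrite !gnorm.
Qed.

End FiniteIndexInStabilizer.

Theorem corollary6p3 (R : realType) (d : nat -> nat)
    (hd : forall j, (2 <= d j)%N)
    (G : groupType) (hG : countable [set: G])
    (a : tree_action d G) (ha : faithful_action a) (hbr : branch_group a)
    (mu : probability (SubBorel G) R)
    (hirs : is_IRS mu) (herg : conj_ergodic mu)
    (hfix : {ae mu, forall H : SubBorel G, clopen (Fix a (carrier H))}) :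
  atomic mu /\
  (just_infinite G ->
   {ae mu, forall H : SubBorel G,
      finite_index (carrier H) (pstab a (Fix a (carrier H)))}).
Proof.
split; first exact: (irs_atomic hd hG ha hbr hirs herg hfix).
move=> ji; apply: ae_imply (ae_resolves hd hG ha hbr hirs hfix) => H [fiH resH].
exact: just_infinite_finite_index.
Qed.
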